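(* (i) Let $M\models T$ be saturated of cardinality $\lambda>|T|$ and let $M'\models T$ have cardinality $\lambda$ with $P^{M'}=P^M$. Then there is an elementary embedding $f:M'\to M$ with $f\restriction P^{M'}=\mathrm{id}$. Moreover, if $A\subseteq M'$ with $|A|<\lambda$, $f:P^M\cup A\to M$ is a partial elementary map, and $a\in M'$, then $f$ can be extended to a partial elementary map on $P^M\cup A\cup\{a\}$ into $M$. (ii) Let $M,M'\models T$ be saturated of the same cardinality $\lambda>|T|$ with $P^M=P^{M'}$. Then $M\cong_P M'$.
   Context: Setting: $T$ is a complete first-order theory whose language contains a distinguished unary predicate $P$ and no function symbols, and $T$ implies $P$ is infinite. $\mathcal C$ is a monster model of $T$; all models are elementary submodels of $\mathcal C$. For a model $M$, $P^M=M\cap P^{\mathcal C}$. Standing hypotheses: (1) every subset of $P^{\mathcal C}$ definable in $\mathcal C$ with parameters is definable with parameters from $P^{\mathcal C}$; (2) every subset of $P^{\mathcal C}$ that is $0$-definable in $\mathcal C$ is $0$-definable in the induced structure on $P^{\mathcal C}$; (3) $T$ has quantifier elimination. $M\cong_P M'$ means there is an isomorphism from $M$ onto $M'$ which is the identity on $P^M$. *)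

(* Defs.v *)
(* MathComp-Analysis (classical sets and cardinality comparison), over which
   relational first-order logic is set up. *)
From mathcomp Require Import all_boot.
From mathcomp Require Import boolp classical_sets functions cardinality.

Set Implicit Arguments.
Unset Strict Implicit.
Unset Printing Implicit Defensive.

Local Open Scope classical_set_scope.
Local Open Scope card_scope.

Definition card_lt {T U : Type} (A : set T) (B : set U) : Prop :=
  (A #<= B) /\ ~ (B #<= A).

Notation "A #< B" := (card_lt A B) (at level 70, no associativity) : card_scope.

(* No function symbols, hence no constant symbols (0-ary functions): every
   subset of a structure is then the universe of a substructure. *)
Record language := Language {
  rel_sym : Type;
  arity : rel_sym -> nat;
  P_sym : rel_sym;
  arity_P : arity P_sym = 1%N
}.

Record structure (L : language) := Structure {
  carrier :> Type;
  interp : forall r : rel_sym L, ('I_(arity r) -> carrier) -> Prop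
}.

Definition P_of {L : language} (M : structure L) : set M :=
  [set x | @interp L M (P_sym L) (fun=> x)].
Arguments P_of {L} M.

(* [formula L V]: first-order formulas whose free variables lie in [V].  In
   [All f], the variable [None] of [f] is bound and [Some v] stands for [v].
   An L(A)-formula is a formula some of whose variables are elements of A, to
   be interpreted as themselves. *)
Inductive formula (L : language) (V : Type) : Type :=
| Bot : formula L V
| Eq : V -> V -> formula L V
| Rel : forall r : rel_sym L, ('I_(arity r) -> V) -> formula L V
| Imp : formula L V -> formula L V -> formula L V
| All : formula L (option V) -> formula L V.

Arguments Bot {L V}.
Arguments Eq {L V}.
Arguments Rel {L V}.
Arguments Imp {L V}.
Arguments All {L V}.

Definition Neg {L : language} {V : Type} (f : formula L V) : formula L V :=
  Imp f Bot.

Fixpoint quantifier_free {L : language} {V : Type} (f : formula L V) : Prop :=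
  match f with
  | Imp g h => quantifier_free g /\ quantifier_free h
  | All _ => False
  | _ => True
  end.

Definition extend_env {V M : Type} (e : V -> M) (x : M) (v : option V) : M :=
  if v is Some u then e u else x.

Fixpoint sat {L : language} (M : structure L) {V : Type} (f : formula L V) :
    (V -> M) -> Prop :=
  match f with
  | Bot => fun=> False
  | Eq u v => fun e => e u = e v
  | Rel r a => fun e => interp (fun i => e (a i))
  | Imp g h => fun e => @sat L M V g e -> @sat L M V h e
  | All g => fun e => forall x : M, @sat L M (option V) g (extend_env e x)
  end.

Arguments sat {L} M {V}.

Definition sentence (L : language) := formula L void.

Definition holds {L : language} (M : structure L) (f : sentence L) : Prop :=
  sat M f (of_void M).

Definition theory (L : language) := set (sentence L).

Definition is_model {L : language} (T : theory L) (M : structure L) : Prop :=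
  inhabited M /\ forall f, T f -> holds M f.

Definition entails {L : language} (T : theory L) (f : sentence L) : Prop :=
  forall M : structure L, is_model T M -> holds M f.

Definition complete_theory {L : language} (T : theory L) : Prop :=
  (exists M : structure L, is_model T M) /\
  forall f : sentence L, entails T f \/ entails T (Neg f).

Definition implies_P_infinite {L : language} (T : theory L) : Prop :=
  forall M : structure L, is_model T M -> infinite_set (P_of M).

Definition quantifier_elimination {L : language} (T : theory L) : Prop :=
  forall (n : nat) (f : formula L 'I_n), exists2 g : formula L 'I_n,
    quantifier_free g &
    forall (M : structure L), is_model T M ->
      forall e : 'I_n -> M, sat M f e <-> sat M g e.

(* |T| is, as usual, the number of L-formulas, i.e. |L| + aleph_0; this is also
   the number of sentences in the deductive closure of T. *)
Definition formulas (L : language) : set (formula L nat) := setT.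
Arguments formulas L : clear implicits.

(* For [A := setT] this is a (total) elementary embedding of M into N. *)
Definition elementary_on {L : language} {M N : structure L} (A : set M)
    (f : M -> N) : Prop :=
  forall (n : nat) (phi : formula L 'I_n) (e : 'I_n -> M),
    (forall i, A (e i)) -> (sat M phi e <-> sat N phi (f \o e)).

Definition elementary_embedding {L : language} {M N : structure L}
    (f : M -> N) : Prop := elementary_on setT f.

Definition isomorphism {L : language} {M N : structure L} (f : M -> N) : Prop :=
  bijective f /\
  forall (r : rel_sym L) (a : 'I_(arity r) -> M), interp a <-> interp (f \o a).

Definition substructure {L : language} {C : structure L} (A : set C) :
    structure L :=
  @Structure L A (fun r a => @interp L C r (fun i => val (a i))).

Definition elementary_submodel {L : language} {C : structure L} (M : set C) :
    Prop :=
  elementary_embedding (val : substructure M -> C).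

(* [option A] is the set of variables of an L(A)-formula in one variable
   [None]. *)
Definition realizes {L : language} {M : structure L} {A : set M} (x : M)
    (p : set (formula L (option A))) : Prop :=
  forall phi, p phi -> sat M phi (extend_env val x).

Definition finitely_satisfiable {L : language} {M : structure L} {A : set M}
    (p : set (formula L (option A))) : Prop :=
  forall q, finite_set q -> q `<=` p -> exists x : M, realizes x q.

Definition kappa_saturated {L : language} (kappa : Type) (M : structure L) :
    Prop :=
  forall A : set M, A #< [set: kappa] ->
  forall p : set (formula L (option A)),
    finitely_satisfiable p -> exists x : M, realizes x p.

Definition saturated {L : language} (M : structure L) : Prop :=
  kappa_saturated M M.

Definition strongly_homogeneous {L : language} (kappa : Type)
    (M : structure L) : Prop :=
  forall A : set M, A #< [set: kappa] ->
  forall f : M -> M, elementary_on A f ->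
    exists2 g : M -> M, isomorphism g & forall x, A x -> g x = f x.

(* The cardinal kappa is represented by a type of that cardinality. *)
Definition monster_model {L : language} (T : theory L) (kappa : Type)
    (C : structure L) : Prop :=
  [/\ is_model T C, formulas L #< [set: kappa],
      kappa_saturated kappa C & strongly_homogeneous kappa C].

Definition definable_over {L : language} {M : structure L} (A : set M)
    {n : nat} (X : set ('I_n -> M)) : Prop :=
  exists phi : formula L ('I_n + A), forall y : 'I_n -> M,
    X y <-> sat M phi (fun v => match v with inl i => y i | inr a => val a end).

(* The next two notions concern subsets of all finite powers of P, as is usual
   for "definable subsets of P". *)
Definition stably_embedded {L : language} (C : structure L) : Prop :=
  forall (n : nat) (X : set ('I_n -> C)),
    (forall y, X y -> forall i, P_of C (y i)) ->
    definable_over setT X -> definable_over (P_of C) X.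

Definition no_new_structure {L : language} (C : structure L) : Prop :=
  forall (n : nat) (X : set ('I_n -> C)),
    (forall y, X y -> forall i, P_of C (y i)) ->
    definable_over set0 X ->
    definable_over (M := substructure (P_of C)) set0
      [set y | X (fun i => val (y i))].

Definition P_part {L : language} {C : structure L} (M : set C) : set C :=
  M `&` P_of C.

Definition identity_on_P {L : language} {C : structure L} {M M' : set C}
    (f : substructure M -> substructure M') : Prop :=
  forall x : substructure M, P_part M (val x) -> val (f x) = val x.

Definition isomorphic_over_P {L : language} {C : structure L} (M M' : set C) :
    Prop :=
  exists2 f : substructure M -> substructure M',
    isomorphism f & identity_on_P f.

(* Main.v *)
(* Let [a] be an element of [M'] and [f] a partial elementary map into [M] defined on
   P and on a set [A] of fewer than lambda further elements.  By stable
   embeddedness, which passes from [C] to [M'], each trace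
   [{y in P | M' |= phi(y, a, c)}], with [c] in [A], is also defined by some
   [psi(y, d)] with [d] in P.  The type of [a] over P and [A] is therefore implied
   by the formulas [forall y in P, phi(y, x, c) <-> psi(y, d)], which involve
   fewer than lambda parameters; the image of this small type under [f] is
   realized in the saturated model [M].  Iterating along a well-order with
   initial segments smaller than lambda, from the identity of P, gives (i), and
   going back and forth gives (ii). *)
Require Import Defs.
From mathcomp Require Import all_boot.
From mathcomp Require Import boolp classical_sets functions cardinality wochoice.

Set Implicit Arguments.
Unset Strict Implicit.
Unset Printing Implicit Defensive.

Local Open Scope classical_set_scope.
Local Open Scope card_scope.

(** * Cardinals *)

Lemma card_le_injP (T U : Type) (A : set T) (B : set U) :
  A #<= B <-> exists f : A -> B, injective f.
Proof.
split=> [/card_leP[f]|[f finj]].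
  by exists f => x y; apply: 'inj_f; rewrite inE.
apply/card_leP/injfunPex; exists f => // x y _ _; exact: finj.
Qed.

Lemma card_leT_injP (T U : Type) :
  [set: T] #<= [set: U] <-> exists f : T -> U, injective f.
Proof.
split=> [/card_le_injP[f finj]|[f finj]].
  pose i (x : T) : [set: T] := SigSub (mem_set (I : [set: T] x)).
  exists (fun x => val (f (i x))) => x y /val_inj/finj.
  by move=> /(congr1 val).
apply/card_leP/injfunPex; exists (fun x => SigSub (mem_set (I : setT (f (val x))))) => //.
by move=> x y _ _ /(congr1 val)/= /finj /val_inj.
Qed.

Lemma card_lt_trans (T U V : Type) (A : set T) (B : set U) (D : set V) :
  A #<= B -> B #< D -> A #< D.
Proof.
move=> AB [BD nDB]; split; first exact: card_le_trans AB BD.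
by move=> DA; apply: nDB; apply: card_le_trans DA AB.
Qed.

Lemma card_lt_le_trans (T U V : Type) (A : set T) (B : set U) (D : set V) :
  A #< B -> B #<= D -> A #< D.
Proof.
move=> [AB nBA] BD; split; first exact: card_le_trans AB BD.
by move=> DA; apply: nBA; apply: card_le_trans BD DA.
Qed.

(** A maximal graph of a partial injection exists by Zorn's lemma. If it missed both some [a] in the
    domain and some [b] in the range, [(a, b)] could be added. *)
Lemma card_le_total (T U : Type) (A : set T) (B : set U) : A #<= B \/ B #<= A.
Proof.
pose good (G : set (A * B)) := forall p q, G p -> G q -> p.1 = q.1 <-> p.2 = q.2.
have [F Fgood Ftot|G [Ggood Gmax]] := @Zorn_bigcup (A * B)%type good.
  move=> p q [X FX Xp] [Y FY Yq].
  by have [XY|YX] := Ftot _ _ FX FY; [apply: (Fgood Y)|apply: (Fgood X)] => //;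
    [exact: XY|exact: YX].
have [hA|/existsNP[a na]] := pselect (forall a, exists b, G (a, b)).
  left; apply/card_le_injP; have [f Gf] := choice hA.
  by exists f => x y fxy; exact/(Ggood _ _ (Gf x) (Gf y)).
have [hB|/existsNP[b nb]] := pselect (forall b, exists a, G (a, b)).
  right; apply/card_le_injP; have [f Gf] := choice hB.
  by exists f => x y fxy; exact/(Ggood _ _ (Gf x) (Gf y)).
exfalso; apply: (Gmax (G `|` [set (a, b)])).
  split=> [p Gp|GG]; first by left.
  by apply: na; exists b; apply: GG; right.
move=> [p1 p2] [q1 q2] [Gp|[-> ->]] [Gq|[-> ->]] //=; first exact: (Ggood _ _ Gp Gq).
- by split=> e; exfalso; [apply: na|apply: nb]; [exists p2|exists p1]; rewrite -e.
- by split=> e; exfalso; [apply: na|apply: nb]; [exists q2|exists q1]; rewrite e.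
Qed.

(* Zorn's lemma, applied to the graphs of injections [D * D -> D] that extend a
   pairing of a countable subset.  If [D] embedded into its complement through
   [g], a maximal graph could be extended to [D `|` g @` D]: the new pairs are
   coded in [D] by [f (f x y) (code b c)] and sent into the complement. *)
Lemma infinite_card_square (X : Type) :
  infinite_set [set: X] -> [set: X * X] #<= [set: X].
Proof.
move=> /infiniteP/card_leT_injP[i iinj].
pose dom (G : set ((X * X) * X)) : set X := [set x | exists z, G ((x, x), z)].
(* [G] is the graph of an injective pairing defined exactly on the square of [dom G], with values in
   [dom G]. *)
pose good G := [/\ forall p q, G p -> G q -> p.1 = q.1 <-> p.2 = q.2,
  forall x y z, G ((x, y), z) -> [/\ dom G x, dom G y & dom G z] &
  forall x y, dom G x -> dom G y -> exists z, G ((x, y), z)].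
pose G0 : set ((X * X) * X) :=
  range (fun p : nat * nat => ((i p.1, i p.2), i (pickle p))).
have domG0 n : dom G0 (i n) by exists (i (pickle (n, n))), (n, n).
have goodG0 : good G0.
  split=> [p q [[a b] _ <-] [[c d] _ <-]|x y z [[a b] _ [<- <- <-]] //|x y].
    split=> /= [[/iinj-> /iinj->] //|/iinj e].
    by have [-> ->] := pcan_inj (@pickleK _) e.
  move=> [z [[a b] _ [<- _ _]]] [t [[c d] _ [<- _ _]]].
  by exists (i (pickle (a, c))), (a, c).
have domS G H : G `<=` H -> dom G `<=` dom H.
  by move=> GH x [z Gxz]; exists z; exact: GH.
(* Joining every graph with [G0] takes care of the empty chain and keeps a copy of the naturals in
   the domain, from which the tags below are taken. *)
have [F Fgood Ftot|A [Agood Amax]] :=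
    @Zorn_bigcup _ (fun F => good (G0 `|` F)).
  have common p q : (G0 `|` \bigcup_(Y in F) Y) p ->
      (G0 `|` \bigcup_(Y in F) Y) q ->
      exists H, [/\ good H, H p, H q & H `<=` G0 `|` \bigcup_(Y in F) Y].
    have sub Y : F Y -> G0 `|` Y `<=` G0 `|` \bigcup_(Y in F) Y.
      by move=> FY; apply: setUS; exact: bigcup_sup.
    move=> [p0|[Y FY Yp]] [q0|[Z FZ Zq]].
    - by exists G0; split=> //; left.
    - by exists (G0 `|` Z); split; [exact: Fgood|left|right|exact: sub].
    - by exists (G0 `|` Y); split; [exact: Fgood|right|left|exact: sub].
    - have [YZ|ZY] := Ftot _ _ FY FZ.
        by exists (G0 `|` Z); split; [exact: Fgood|right; exact: YZ|right|exact: sub].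
      by exists (G0 `|` Y); split; [exact: Fgood|right|right; exact: ZY|exact: sub].
  split=> [p q Gp Gq|x y z Gz|x y [z Gx] [t Gy]].
  - by have [H [[+ _ _] Hp Hq _]] := common _ _ Gp Gq; apply.
  - have [H [[_ + _] Hz _ HG]] := common _ _ Gz Gz.
    by move=> /(_ _ _ _ Hz)[? ? ?]; split; apply: domS HG _ _.
  - have [H [[_ _ +] Hx Hy HG]] := common _ _ Gx Gy.
    have Hdx : dom H x by exists z.
    have Hdy : dom H y by exists t.
    by move=> /(_ _ _ Hdx Hdy)[w Hw]; exists w; exact: HG.
set G := G0 `|` A in Agood; set D := dom G.
have [Ginj Gdom Gtot] := Agood.
have Di n : D (i n) by apply: domS (domG0 n); left.
have /choice[F0 F0G] (p : X * X) : exists z, D p.1 -> D p.2 -> G (p, z).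
  have [[p1 p2]|np] := pselect (D p.1 /\ D p.2).
    by have [z Gz] := Gtot _ _ p1 p2; exists z; rewrite (surjective_pairing p).
  by exists p.1 => p1 p2; exfalso; apply: np.
pose f x y := F0 (x, y).
have fG x y : D x -> D y -> G ((x, y), f x y) by move=> ? ?; exact: F0G.
have fD x y : D x -> D y -> D (f x y) by move=> Dx Dy; have [] := Gdom _ _ _ (fG _ _ Dx Dy).
have finj x y x' y' : D x -> D y -> D x' -> D y' -> f x y = f x' y' ->
    x = x' /\ y = y'.
  move=> Dx Dy Dx' Dy' e.
  by have [_ /(_ e)[-> ->]] := Ginj _ _ (fG _ _ Dx Dy) (fG _ _ Dx' Dy').
(* If the complement of [D] embeds into [D], then so does [X], with the tags [i 0] and [i 1]
   separating the two pieces; the pairing of [D] then pairs [X]. *)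
have [/card_le_injP[g ginj]|/card_le_injP[g ginj]] := card_le_total D (~` D); last first.
  pose h x := match pselect (D x) with
    | left _ => f x (i 0)
    | right nDx => f (val (g (SigSub (mem_set (nDx : (~` D) x))))) (i 1) end.
  have gD z : D (val (g z)) by exact/set_mem/(valP (g z)).
  have hD x : D (h x) by rewrite /h; case: pselect => // ?; exact: fD.
  have hinj : injective h.
    move=> x y; rewrite /h; case: pselect => hx; case: pselect => hy.
    - by move=> /finj[].
    - by move=> /finj[] // _ /iinj.
    - by move=> /finj[] // _ /iinj.
    - by move=> /finj[] // /val_inj/ginj/(congr1 val).
  apply/card_leT_injP; exists (fun p => f (h p.1) (h p.2)) => -[a b] [c d] /=.
  by move=> /finj[] // /hinj-> /hinj->.
exfalso.
have [g' g'nD g'inj] : exists2 g' : X -> X, forall x, D x -> ~ D (g' x) &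
    forall x y, D x -> D y -> g' x = g' y -> x = y.
  exists (fun x => match pselect (D x) with
    | left Dx => val (g (SigSub (mem_set Dx))) | right _ => x end).
    by move=> x Dx; case: pselect => // Dx'; exact: (set_mem (valP (g _))).
  move=> x y Dx Dy; case: pselect => // Dx'; case: pselect => // Dy'.
  by move=> /val_inj/ginj/(congr1 val).
pose j (b : bool) x := if b then g' x else x.
have jinj b c x y : D x -> D y -> j b x = j c y -> b = c /\ x = y.
  move=> Dx Dy; case: b; case: c => /= e.
  - by split=> //; exact: g'inj.
  - by have := g'nD _ Dx; rewrite e.
  - by have := g'nD _ Dy; rewrite -e.
  - by [].
pose code (b c : bool) := i (b.*2 + c).
have codeinj b c b' c' : code b c = code b' c' -> b = b' /\ c = c'.
  by move=> /iinj; case: b; case: c; case: b'; case: c'.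
(* The condition [b || c] selects the three blocks of the larger square other than [D * D]; [code]
   tells them apart, and [g'] makes the values new. *)
pose N : set ((X * X) * X) := [set p | exists x y (b c : bool),
  [/\ D x, D y, b || c & p = ((j b x, j c y), g' (f (f x y) (code b c)))]].
have dN x y b c : D x -> D y -> D (f (f x y) (code b c)).
  by move=> Dx Dy; exact: (fD _ _ (fD _ _ Dx Dy) (Di _)).
have jD b c x y : D x -> D y -> b || c -> ~ (D (j b x) /\ D (j c y)).
  move=> Dx Dy; case: b => [_ [D1 _]|/= -> [_ D2]]; first exact: g'nD D1.
  exact: g'nD D2.
apply: (Amax (A `|` N)).
  split=> [p Ap|AN]; first by left.
  have : A ((g' (i 0), g' (i 0)), g' (f (f (i 0) (i 0)) (code true true))).
    by apply: AN; right; exists (i 0), (i 0), true, true; split.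
  by move=> HA; have [] := Gdom _ _ _ (or_intror HA : G _); move/g'nD: (Di 0).
rewrite setUA -/G.
have domN u : dom (G `|` N) u <-> exists b x, D x /\ u = j b x.
  split=> [[z [Gz|[x [y [b [c [Dx Dy _ [-> _ _]]]]]]]]|[b [x [Dx ->]]]].
  - by exists false, u; split=> //; exists z.
  - by exists b, x.
  - case: b; last by case: Dx => z Gz; exists z; left.
    by exists (g' (f (f x x) (code true true))); right; exists x, x, true, true.
have GN : G `<=` G `|` N by left.
split=> [p q|u v z|u v].
- move=> [Gp|[x [y [b [c [Dx Dy bc ->]]]]]] [Gq|[x' [y' [b' [c' [Dx' Dy' bc' ->]]]]]].
  + exact: Ginj.
  + have [Dp1 Dp2 Dp] : [/\ D p.1.1, D p.1.2 & D p.2] by apply: Gdom; case: (p) Gp => -[].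
    split=> /= e; exfalso; last by apply: (g'nD (f (f x' y') (code b' c'))); [exact: dN|rewrite -e].
    by apply: (jD b' c' x' y') => //; move: Dp1 Dp2; rewrite e.
  + have [Dp1 Dp2 Dp] : [/\ D q.1.1, D q.1.2 & D q.2] by apply: Gdom; case: (q) Gq => -[].
    split=> /= e; exfalso; last by apply: (g'nD (f (f x y) (code b c))); [exact: dN|rewrite e].
    by apply: (jD b c x y) => //; move: Dp1 Dp2; rewrite -e.
  + split=> /= [[/jinj[] // -> -> /jinj[] // -> ->] //|].
    move=> /(g'inj _ _ (dN _ _ b c Dx Dy) (dN _ _ b' c' Dx' Dy')).
    move=> /(finj _ _ _ _ (fD _ _ Dx Dy) (Di _) (fD _ _ Dx' Dy') (Di _))[].
    by move=> /(finj _ _ _ _ Dx Dy Dx' Dy')[-> ->] /codeinj[-> ->].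
- move=> [/Gdom[? ? ?]|[x [y [b [c [Dx Dy bc [-> -> ->]]]]]]].
    by split; exact: domS GN _ _.
  split; apply/domN; [by exists b, x|by exists c, y|].
  by exists true, (f (f x y) (code b c)); split; first exact: dN.
- move=> /domN[b [x [Dx ->]]] /domN[c [y [Dy ->]]].
  have [bc|] := boolP (b || c).
    by exists (g' (f (f x y) (code b c))); right; exists x, y, b, c.
  case: b => //; case: c => // _.
  by exists (f x y); left; exact: fG.
Qed.

(** Iterated pairing determines a list once its length is known, so the length is stored beside the
    code. *)
Lemma infinite_card_seq (X : Type) :
  infinite_set [set: X] -> [set: seq X] #<= [set: X].
Proof.
move=> infX.
have /card_leT_injP[f finj] := infinite_card_square infX.
have /infiniteP/card_leT_injP[i iinj] := infX.
pose code := foldr (fun x z => f (x, z)) (i 0).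
apply/card_leT_injP; exists (fun s => f (i (size s), code s)) => s t.
move=> /finj[/iinj + ].
elim: s t => [|x s IHs] [|y t] //= [est] /finj[-> ecode].
by rewrite (IHs t).
Qed.

(* Cut an arbitrary well-order at the first initial segment as large as the
   whole type, and transport the order back to the type. *)
Lemma small_well_order (U : Type) : exists lt : U -> U -> Prop,
  [/\ well_founded lt, forall x y, [\/ lt x y, x = y | lt y x],
      forall x y z, lt x y -> lt y z -> lt x z &
      forall w, [set v | lt v w] #< [set: U]].
Proof.
have [R0 R0wo] := well_ordering_principle {classic U}.
pose lt0 (x y : U) := ~ R0 y x.
have min0 (A : set U) : A !=set0 -> exists2 z, A z & forall x, A x -> ~ lt0 x z.
  move=> [x Ax]; have [|z [[zA zmin] _]] := R0wo (fun x => `[< A x >]).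
    by exists x; apply/asboolP.
  exists z; first exact/asboolP.
  by move=> y Ay; apply; apply: zmin; apply/asboolP.
have wf0 : well_founded lt0.
  move=> x; apply: contrapT => nx.
  have [z nz zmin] := min0 [set x | ~ Acc lt0 x] (ex_intro _ x nx).
  by apply: nz; constructor => y yz; apply: contrapT => /zmin.
have tri0 x y : [\/ lt0 x y, x = y | lt0 y x].
  have [xy|nxy] := boolP (R0 x y); last by constructor 3; apply/negP.
  have [yx|nyx] := boolP (R0 y x); last by constructor 1; apply/negP.
  (* Antisymmetry: both [x] and [y] are least in the pair they form, and least elements are
     unique. *)
  constructor 2.
  have [|z [_ zu]] := R0wo (fun z : {classic U} => (z == x) || (z == y)).
    by exists x; apply/orP; left.
  have refl t : R0 t t.
    have [|v [[/eqP vt vmin] _]] := R0wo (fun z : {classic U} => z == t).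
      by exists t; exact: eqxx.
    by have := vmin t (eqxx t); rewrite vt.
  rewrite -(zu x); first rewrite -(zu y) //.
    split; first by apply/orP; right.
    by move=> t /orP[/eqP->|/eqP->].
  split; first by apply/orP; left.
  by move=> t /orP[/eqP->|/eqP->].
have irr x : ~ lt0 x x.
  have [t ->] := min0 [set t | t = x] (ex_intro _ x erefl).
  by move=> /(_ x erefl).
have trans0 x y z : lt0 x y -> lt0 y z -> lt0 x z.
  move=> xy yz; have [//|e|zx] := tri0 x z; exfalso.
    have [t [->|->]] := min0 [set t | t = x \/ t = y] (ex_intro _ x (or_introl erefl)).
      by move=> /(_ y (or_intror erefl)); rewrite e.
    by move=> /(_ x (or_introl erefl)).
  have [|t [->|->|->]] := min0 [set t | [\/ t = x, t = y | t = z]].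
  - by exists x; constructor 1.
  - by move=> /(_ z); apply => //; constructor 3.
  - by move=> /(_ x); apply => //; constructor 1.
  - by move=> /(_ y); apply => //; constructor 2.
pose large := [set w | [set: U] #<= [set v | lt0 v w]].
have [/min0[w /card_le_injP[g0 g0inj] wmin]|nlarge] := pselect (large !=set0); last first.
  exists lt0; split=> // w; split; first exact: card_leT.
  by move=> h; apply: nlarge; exists w.
pose g (x : U) : U := val (g0 (SigSub (mem_set (I : [set: U] x)))).
have glt x : lt0 (g x) w by exact: (set_mem (valP (g0 _))).
have ginj : injective g by move=> x y /val_inj/g0inj/(congr1 val).
exists (fun x y => lt0 (g x) (g y)); split.
- have acc y : Acc lt0 y -> forall x, g x = y -> Acc (fun x z => lt0 (g x) (g z)) x.
    by elim=> {}y _ IHy x e; constructor => z zx; apply: (IHy (g z)); rewrite -?e.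
  by move=> x; exact: acc (wf0 _) _ erefl.
- move=> x y; have [h|/ginj h|h] := tri0 (g x) (g y);
    by [constructor 1|constructor 2|constructor 3].
- by move=> x y z; exact: trans0.
(* A segment as large as [U] would make the segment below [g z] large, against the minimality of
   [w]. *)
- move=> z; split; first exact: card_leT.
  move=> h; apply: (wmin (g z)) => //; apply: card_le_trans h _.
  have gA : g @` [set v | lt0 (g v) (g z)] `<=` [set v | lt0 v (g z)].
    by move=> _ [v vz <-].
  apply: card_le_trans (subset_card_le gA).
  by have /card_eqPle[] := inj_card_eq (A := [set v | lt0 (g v) (g z)]) (in2W ginj).
Qed.

(** * Transfinite constructions of finite character *)

(** [D w] is the demand met at stage [w]; the second hypothesis is the finite character of [good].
    The values before a stage form a good set because finitely many of them already occur up to the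
    largest of their indices. *)
Lemma transfinite_construction (U Z : Type) (good : set (set Z))
    (D : U -> set Z) :
  good set0 ->
  (forall S, (forall n (e : 'I_n -> Z), (forall i, S (e i)) ->
     exists2 S', good S' & forall i, S' (e i)) -> good S) ->
  (forall S w, S #< [set: U] -> good S ->
     exists2 z, D w z & good (S `|` [set z])) ->
  exists2 h : U -> Z, forall w, D w (h w) & good (range h).
Proof.
move=> good0 goodfin step.
have [lt [wf tri trans small]] := small_well_order U.
have [u0|/asboolP nU] := pselect (inhabited U); last first.
  have noU (u : U) : False by move/asboolP: nU; apply; exists.
  exists (fun u => match noU u with end) => [u|]; first by have := noU u.
  by apply: goodfin => n e eI; exists set0 => // i; have [u] := eI i; have := noU u.
(* Away from small good sets the value of [next] is arbitrary; a step from [set0] supplies one. *)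
have /choice[next nextP] (Sw : set Z * U) : exists z,
    Sw.1 #< [set: U] -> good Sw.1 -> D Sw.2 z /\ good (Sw.1 `|` [set z]).
  have [[Ssmall Sgood]|nS] := pselect (Sw.1 #< [set: U] /\ good Sw.1).
    by have [z Dz Gz] := step _ Sw.2 Ssmall Sgood; exists z.
  case: u0 => u0.
  have [z _ _] := step set0 u0 (card_lt_trans (card_ge0 _ _) (small u0)) good0.
  by exists z => s g; exfalso; apply: nS.
pose body (w : U) (rec : forall v, lt v w -> Z) :=
  next ([set z | exists v (vw : lt v w), z = rec v vw], w).
pose h := Fix wf (fun=> Z) body.
have hE w : h w = next (h @` [set v | lt v w], w).
  rewrite /h Fix_eq => [|x f g fg]; last first.
    by congr body; apply: functional_extensionality_dep => v;
      apply: functional_extensionality_dep.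
  rewrite /body; congr (next (_, w)); apply/seteqP; split=> z.
    by move=> [v [vw ->]]; exists v.
  by move=> [v vw <-]; exists v, vw.
have hsmall w : h @` [set v | lt v w] #< [set: U].
  exact: card_lt_trans (card_image_le _ _) (small w).
have max n (v : 'I_n.+1 -> U) : exists i0, forall i, lt (v i) (v i0) \/ v i = v i0.
  elim: n v => [|n IHn] v; first by exists ord0 => i; right; rewrite (ord1 i).
  have [i0 i0max] := IHn (v \o lift ord0).
  have [lt0|eq0|gt0] := tri (v ord0) (v (lift ord0 i0)).
  - exists (lift ord0 i0) => i; case: (unliftP ord0 i) => [k ->|->]; last by left.
    exact: i0max.
  - exists (lift ord0 i0) => i; case: (unliftP ord0 i) => [k ->|->]; last by right.
    exact: i0max.
  - exists ord0 => i; case: (unliftP ord0 i) => [k ->|->]; last by right.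
    left; case: (i0max k) => /= [|->] //; by move=> /trans; apply.
have bound (I : set U) :
    (forall w, I w -> good (h @` [set v | lt v w] `|` [set h w])) ->
    good (h @` I).
  move=> gI; apply: goodfin => -[|n] e eI; first by exists set0 => // -[].
  have /choice[v vP] i : exists v, I v /\ h v = e i.
    by have [v Iv ve] := eI i; exists v.
  have [i0 i0max] := max n v; exists (h @` [set u | lt u (v i0)] `|` [set h (v i0)]).
    by apply: gI; case: (vP i0).
  move=> i; have [_ <-] := vP i.
  by case: (i0max i) => [lti|->]; [left; exists (v i)|right].
have hgood w : D w (h w) /\ good (h @` [set v | lt v w] `|` [set h w]).
  elim/(well_founded_ind wf): w => w IHw; rewrite !(hE w).
  apply: (nextP (_, w)); first exact: hsmall.
  by apply: bound => v vw; case: (IHw _ vw).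
by exists h => [w|]; [|apply: bound => w _]; case: (hgood w).
Qed.

(** * Formulas *)

Fixpoint rename {L : language} {V : Type} (f : formula L V) {W : Type} :
    (V -> W) -> formula L W :=
  match f with
  | Bot => fun=> Bot
  | Eq u v => fun r => Eq (r u) (r v)
  | Rel s a => fun r => Rel s (fun i => r (a i))
  | Imp g h => fun r => Imp (rename g r) (rename h r)
  | All g => fun r => All (rename g (omap r))
  end.

Section Formulas.
Variable L : language.

Lemma rename_comp (V : Type) (f : formula L V) (W X : Type) (r : V -> W)
    (s : W -> X) : rename (rename f r) s = rename f (s \o r).
Proof.
elim: f W X r s => //= {V} [V g IHg h IHh|V g IHg] W X r s; first by rewrite IHg IHh.
by rewrite IHg; congr (All (rename g _)); apply/funext => -[].
Qed.

Lemma sat_rename (M : structure L) (V : Type) (f : formula L V) (W : Type)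
    (r : V -> W) (e : W -> M) : sat M (rename f r) e <-> sat M f (e \o r).
Proof.
elim: f W r e => //= {V} [V g IHg h IHh|V g IHg] W r e; first by rewrite IHg IHh.
suff E x : extend_env e x \o omap r = extend_env (e \o r) x.
  by split=> H x; have := H x; rewrite IHg E.
by apply/funext => -[].
Qed.

(** The induction uses arbitrary finite types, which are closed under sums and subtypes; numbering
    by ordinals comes only at the end. *)
Lemma finite_support (V : Type) (f : formula L V) :
  exists (n : nat) (g : formula L 'I_n) (r : 'I_n -> V), f = rename g r.
Proof.
suff [F [g [r ->]]] :
    exists (F : finType) (g : formula L F) (r : F -> V), f = rename g r.
  exists #|F|, (rename g enum_rank), (r \o enum_val); rewrite rename_comp.
  by congr rename; apply/funext => x /=; rewrite enum_rankK.
elim: f => {V} [V|V u v|V s a|V _ [F [g [r ->]]] _ [F' [g' [r' ->]]]|V _ [F [g [r ->]]]].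
- by exists void, Bot, (of_void V).
- by exists bool, (Eq true false), (fun b => if b then u else v).
- by exists 'I_(arity s), (Rel s id), a.
- exists (F + F')%type, (Imp (rename g inl) (rename g' inr)).
  exists (fun x => match x with inl x => r x | inr x => r' x end).
  by rewrite /= !rename_comp.
(* Only variables that [r] leaves free survive; [insub] sends the others to the bound [None]. *)
- have /choice[r0 r0P] (x : {x : F | isSome (r x)}) : exists v, r (val x) = Some v.
    by case: x => x /=; case: (r x) => // v; exists v.
  exists {x : F | isSome (r x)}, (All (rename g insub)), r0.
  rewrite /= rename_comp; congr (All (rename g _)); apply/funext => x /=.
  by case: insubP => [y _ <- /=|]; [rewrite r0P|case: (r x)].
Qed.

Definition sum_env (V W : Type) (M : Type) (y : V -> M) (e : W -> M) (x : V + W) :=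
  match x with inl v => y v | inr w => e w end.

(** [unlift ord0] peels off the first tuple variable, which the outermost quantifier binds as
    [None], and renumbers the others. *)
Fixpoint all_P (n : nat) : forall V : Type, formula L ('I_n + V) -> formula L V :=
  match n with
  | 0 => fun V f => rename f (fun x : 'I_0 + V =>
      match x with inl i => match notF (ltn_ord i) with end | inr v => v end)
  | n.+1 => fun V f => All (Imp (Rel (P_sym L) (fun=> None))
      (all_P (rename f (fun x : 'I_n.+1 + V => match x with
        | inl i => if unlift ord0 i is Some j then inl j else inr None
        | inr v => inr (Some v) end))))
  end.

Lemma sat_all_P (M : structure L) (n : nat) (V : Type)
    (f : formula L ('I_n + V)) (e : V -> M) :
  sat M (all_P f) e <->
  forall y : 'I_n -> M, (forall i, P_of M (y i)) -> sat M f (sum_env y e).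
Proof.
elim: n V f e => [|n IHn] V f e /=.
  have E y : e \o (fun x : 'I_0 + V => match x with
      inl i => match notF (ltn_ord i) with end | inr v => v end) = sum_env y e.
    by apply/funext => -[i|] //; case: (notF (ltn_ord i)).
  rewrite sat_rename; split=> [H y _|]; first by rewrite -E.
  move=> /(_ (fun i => match notF (ltn_ord i) with end)); rewrite -E; apply.
  by move=> i; case: (notF (ltn_ord i)).
have E y x : sum_env y (extend_env e x) \o (fun u : 'I_n.+1 + V => match u with
        | inl i => if unlift ord0 i is Some j then inl j else inr None
        | inr v => inr (Some v) end) =
    sum_env (fun i => if unlift ord0 i is Some j then y j else x) e.
  by apply/funext => -[i|] //=; case: unlift.
split=> [H y Py|H x Px].
  have /IHn := H (y ord0) (Py ord0).
  move=> /(_ (y \o lift ord0) (fun i => Py _)); rewrite sat_rename E.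
  congr (sat M f (sum_env _ e)); apply/funext => i.
  by case: unliftP => [j ->|->].
apply/IHn => y Py; rewrite sat_rename E; apply: H => i.
by case: unlift.
Qed.

Definition iff_formula (V : Type) (f g : formula L V) : formula L V :=
  Neg (Imp (Imp f g) (Neg (Imp g f))).

Lemma sat_iff_formula (M : structure L) (V : Type) (f g : formula L V) (e : V -> M) :
  sat M (iff_formula f g) e <-> (sat M f e <-> sat M g e).
Proof.
split=> [/= H|[H1 H2] /=]; last by apply.
by split=> s; apply: contrapT => n; apply: H => H1 H2; apply: n; [exact: H1|exact: H2].
Qed.

(** The formula is chosen before the structure, so the same one can be evaluated in two models. *)
Lemma finite_conjunction (V : Type) (q : set (formula L V)) : finite_set q ->
  exists f : formula L V, forall (M : structure L) (e : V -> M),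
    sat M f e <-> forall g, q g -> sat M g e.
Proof.
move=> /(@finite_seqP {classic formula L V})[s ->]; elim: s => [|g s [f fP]].
  by exists (Imp Bot Bot) => M e; split=> // _ g /=.
exists (Neg (Imp g (Neg f))) => M e; split=> [/= H h|H /=].
  rewrite inE => /orP[/eqP->|hs].
    by apply: contrapT => ng; apply: H => /ng.
  by apply: contrapT => nh; apply: H => _ /fP /(_ h hs).
apply; first by apply: H; rewrite /= inE eqxx.
by apply/fP => h hs; apply: H; rewrite /= inE; apply/orP; right.
Qed.

End Formulas.

(** * Partial elementary maps *)

Section PartialElementary.
Variable L : language.

(** A formula mentions finitely many variables, so variables may range over any type, such as a
    whole set of parameters. *)
Lemma elementary_on_sat (M N : structure L) (A : set M) (f : M -> N) :
  elementary_on A f -> forall (V : Type) (phi : formula L V) (e : V -> M),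
  (forall v, A (e v)) -> (sat M phi e <-> sat N phi (f \o e)).
Proof.
move=> fA V phi e eA; have [n [g [r ->]]] := finite_support phi.
by rewrite !sat_rename; apply: fA => i; exact: eA.
Qed.

(* A partial map is represented by its graph. *)
Definition partial_elementary (M N : structure L) (R : set (M * N)) : Prop :=
  forall (n : nat) (phi : formula L 'I_n) (e : 'I_n -> M * N),
    (forall i, R (e i)) -> (sat M phi (fst \o e) <-> sat N phi (snd \o e)).

Lemma partial_elementary_sat (M N : structure L) (R : set (M * N)) :
  partial_elementary R -> forall (V : Type) (phi : formula L V) (e : V -> M * N),
  (forall v, R (e v)) -> (sat M phi (fst \o e) <-> sat N phi (snd \o e)).
Proof.
move=> Rpe V phi e eR; have [n [g [r ->]]] := finite_support phi.
by rewrite !sat_rename; apply: (Rpe n g (e \o r)) => i; exact: eR.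
Qed.

Lemma partial_elementary_sub (M N : structure L) (R S : set (M * N)) :
  R `<=` S -> partial_elementary S -> partial_elementary R.
Proof. by move=> RS Sel n phi e eR; apply: Sel => i; exact: RS. Qed.

Lemma partial_elementary_swap (M N : structure L) (R : set (M * N)) :
  partial_elementary R -> partial_elementary [set z | R (z.2, z.1)].
Proof.
move=> Rpe n phi e eR; symmetry.
exact: (Rpe n phi (fun i => ((e i).2, (e i).1))).
Qed.

Lemma partial_elementary_inj (M N : structure L) (R : set (M * N)) (p q : M * N) :
  partial_elementary R -> R p -> R q -> p.1 = q.1 <-> p.2 = q.2.
Proof.
move=> Rpe Rp Rq.
apply: (partial_elementary_sat Rpe (Eq true false)
  (e := fun b : bool => if b then p else q)).
by case.
Qed.

Lemma partial_elementary_P (M N : structure L) (R : set (M * N)) (p : M * N) :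
  partial_elementary R -> R p -> P_of M p.1 <-> P_of N p.2.
Proof.
move=> Rpe Rp.
exact: (partial_elementary_sat Rpe (Rel (P_sym L) (fun=> tt)) (e := fun=> p)).
Qed.

(** Stable embeddedness read inside [N]. The tuple [d] is finite so that its existence can be stated
    by one formula. *)
Definition P_traces_definable (N : structure L) : Prop :=
  forall (n : nat) (V : Type) (phi : formula L ('I_n + V)) (c : V -> N),
  exists (k : nat) (psi : formula L ('I_n + 'I_k)) (d : 'I_k -> N),
    (forall i, P_of N (d i)) /\
    forall y, (forall i, P_of N (y i)) ->
      (sat N phi (sum_env y c) <-> sat N psi (sum_env y d)).

(** For a fixed [psi], having a defining tuple in [P] is a first-order property of [c]; this is what
    carries it from a model to its elementary submodels. *)
Lemma trace_formula (n k : nat) (V : Type) (phi : formula L ('I_n + V))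
    (psi : formula L ('I_n + 'I_k)) : exists chi : formula L V,
  forall (M : structure L) (c : V -> M), sat M chi c <->
    exists d : 'I_k -> M, (forall i, P_of M (d i)) /\
    forall y, (forall i, P_of M (y i)) ->
      (sat M phi (sum_env y c) <-> sat M psi (sum_env y d)).
Proof.
pose phi' : formula L ('I_n + ('I_k + V)) := rename phi (fun x =>
  match x with inl i => inl i | inr v => inr (inr v) end).
pose psi' : formula L ('I_n + ('I_k + V)) := rename psi (fun x =>
  match x with inl i => inl i | inr j => inr (inl j) end).
exists (Neg (all_P (Neg (all_P (iff_formula phi' psi'))))) => M c.
have E d : sat M (all_P (iff_formula phi' psi')) (sum_env d c) <->
    forall y, (forall i, P_of M (y i)) ->
      (sat M phi (sum_env y c) <-> sat M psi (sum_env y d)).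
  have E1 y : sum_env y (sum_env d c) \o (fun x =>
      match x with inl i => inl i | inr v => inr (inr v) end) = sum_env y c.
    by apply/funext => -[].
  have E2 y : sum_env y (sum_env d c) \o (fun x =>
      match x with inl i => inl i | inr j => inr (inl j) end) = sum_env y d.
    by apply/funext => -[].
  by rewrite sat_all_P; split=> H y /H; rewrite sat_iff_formula !sat_rename E1 E2.
split=> [/= H|[d [Pd H]] /=].
  apply: contrapT => nH; apply: H; apply/sat_all_P => d Pd /= /E Hd.
  by apply: nH; exists d.
by move=> /sat_all_P /(_ d Pd); apply; exact/E.
Qed.

(** Stable embeddedness gives [psi] with parameters in the [P] of [C]. So [chi] holds at [c] in [C],
    hence in [M], where it yields parameters in the [P] of [M]. *)
Lemma submodel_P_traces_definable (C : structure L) (M : set C) :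
  stably_embedded C -> P_of C !=set0 -> elementary_submodel M ->
  P_traces_definable (substructure M).
Proof.
move=> Cse [p0 Pp0] MC n V phi c.
pose X : set ('I_n -> C) := [set y | (forall i, P_of C (y i)) /\
  sat C phi (sum_env y (val \o c))].
have : definable_over setT X.
  pose F0 : set (formula L ('I_n + [set: C])) :=
    range (fun i : 'I_n => Rel (P_sym L) (fun=> inl i)) `|`
    [set rename phi (fun x => match x with inl i => inl i
       | inr v => inr (SigSub (mem_set (I : [set: C] (val (c v))))) end)].
  have [|f fP] := @finite_conjunction _ _ F0.
    rewrite finite_setU; split; last exact: finite_set1.
    exact/finite_image/finite_finset.
  exists f => y; rewrite fP; split.
    move=> [Py sphi] g [[i _ <-]|->]; first exact: Py.
    rewrite sat_rename; congr (sat C phi _): sphi.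
    by apply/funext => -[].
  move=> H; split=> [i|]; first by apply: (H (Rel (P_sym L) (fun=> inl i))); left; exists i.
  have := H _ (or_intror erefl); rewrite sat_rename; congr (sat C phi _).
  by apply/funext => -[].
move=> /Cse[|psi0]; first by move=> y [].
have [k [g [r ->]]] := finite_support psi0 => psi0P.
(* Every variable of [g] gets a parameter slot. Slots of tuple variables are never read; they
   receive the default [p0]. *)
pose psi : formula L ('I_n + 'I_k) := rename g (fun x =>
  match r x with inl i => inl i | inr _ => inr x end).
have [chi chiP] := trace_formula phi psi.
exists k, psi; apply/chiP.
apply/(elementary_on_sat MC) => //; apply/chiP.
exists (fun x => match r x with inl _ => p0 | inr a => val a end); split.
  by move=> i; case: (r i) => // a; exact: (set_mem (valP a)).
move=> y Py; transitivity (X y); first by split=> [|[]].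
rewrite psi0P !sat_rename.
suff -> : (fun v : 'I_n + P_of C => match v with inl i => y i | inr a => val a end) \o r =
  sum_env y (fun x => match r x with inl _ => p0 | inr a => val a end) \o
    (fun x => match r x with inl i => inl i | inr _ => inr x end) by [].
by apply/funext => x /=; case E: (r x) => [i|a] //=; rewrite E.
Qed.

Lemma formulas_infinite : infinite_set (formulas L).
Proof.
by apply/infiniteP/card_leT_injP; exists (fun n => Eq 0 n) => m n [].
Qed.

End PartialElementary.

(** * Extending a partial elementary map by one element *)

Section OneStep.
Variable L : language.

(** The larger of the two cardinals is infinite and still below [E], so finite lists over it remain
    below [E]. *)
Lemma common_card_bound (U V W : Type) (A : set U) (B : set V) (E : set W) :
  infinite_set A -> A #< E -> B #< E -> exists X : Type,
  [/\ infinite_set [set: X], [set: X] #< E, A #<= [set: X] & B #<= [set: X]].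
Proof.
move=> infA AE BE; have [AB|BA] := card_le_total A B; [exists B|exists A].
  have BT : B #<= [set: B] by have /card_eqPle[] := card_setT B.
  have TB : [set: B] #<= B by have /card_eqPle[] := card_setT B.
  split=> //; [|exact: card_lt_trans TB BE|exact: card_le_trans AB BT].
  by move=> /(card_le_finite (card_le_trans AB BT)).
have AT : A #<= [set: A] by have /card_eqPle[] := card_setT A.
have TA : [set: A] #<= A by have /card_eqPle[] := card_setT A.
split=> //; [|exact: card_lt_trans TA AE|exact: card_le_trans BA AT].
by move=> /(card_le_finite AT).
Qed.

(* Indexes the formulas over finitely many variables for elements of [P] and
   the variables [option R]: in [(phi, (n, s))], the variables [i < n] of [phi]
   stand for elements of [P] and the variable [n + j] for [s_j]. *)
Definition instance (R : Type) := (formula L nat * (nat * seq (option R)))%type.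

Definition instance_formula (R : Type) (u : instance R) :
    formula L ('I_u.2.1 + option R) :=
  rename u.1 (fun v => if insub v is Some i then inl i
                       else inr (nth None u.2.2 (v - u.2.1))).

(** Position [i] is coded by [i] if it belongs to [B] and by [n + i] otherwise. The casts absorb the
    dependence of the formula's type on [u.2.1]. *)
Lemma instanceP (R : Type) (n : nat) (phi : formula L 'I_n)
    (B : set 'I_n) (c : 'I_n -> option R) : exists u : instance R,
  exists h : u.2.1 = n, rename (instance_formula u) id =
    rename phi (fun i => if `[< B i >] then inl (cast_ord (esym h) i) else inr (c i)).
Proof.
exists (rename phi (fun i : 'I_n => if `[< B i >] then val i else n + i),
  (n, [seq c i | i <- enum 'I_n])), erefl.
rewrite !rename_comp /=; congr rename; apply/funext => i /=.
case: ifP => _.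
  by rewrite valK cast_ord_id.
rewrite insubF; last by rewrite ltnNge leq_addr.
by rewrite addKn (nth_map i) ?size_enum_ord // nth_ord_enum.
Qed.

(** Everything is coded by finite lists over [X]; list lengths separate the two summands. *)
Lemma card_parameters (R : Type) (k : instance R -> nat) (X : Type) :
  infinite_set [set: X] -> formulas L #<= [set: X] -> [set: R] #<= [set: X] ->
  [set: (R + {u : instance R & 'I_(k u)})] #<= [set: X].
Proof.
move=> infX /card_leT_injP[i1 i1inj] /card_leT_injP[i2 i2inj].
have /infiniteP/card_leT_injP[i3 i3inj] := infX.
have /card_leT_injP[i4 i4inj] := infinite_card_seq infX.
pose eo (o : option R) := i4 (if o is Some r then [:: i2 r] else [::]).
have eoinj : injective eo by move=> [r|] [r'|] /i4inj // [/i2inj->].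
pose eu (u : instance R) := i4 (i1 u.1 :: i3 u.2.1 :: map eo u.2.2).
have euinj : injective eu.
  by move=> [f [n s]] [f' [n' s']] /i4inj[/i1inj-> /i3inj-> /(inj_map eoinj)->].
apply/card_leT_injP; exists (fun x => i4 (match x with
  | inl r => [:: i2 r] | inr (existT u j) => [:: eu u; i3 (val j)] end)).
move=> [r|[u j]] [r'|[u' j']] /i4inj //; first by move=> [/i2inj->].
move=> [/euinj e]; case: u' / e j' => j' /i3inj e.
by congr (inr (existT _ _ _)); exact: val_inj.
Qed.

(** [Q] is the part of the map over [P], of unrestricted size; only [R] is small. Saturation is
    applied to the formulas [theta u] alone. *)
Lemma partial_elementary_extend (M N : structure L) (Q R : set (M * N)) (a : M) :
  P_traces_definable M -> P_of M !=set0 -> saturated N ->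
  formulas L #< [set: N] -> R #< [set: N] ->
  (forall z, Q z -> P_of M z.1) ->
  (forall x, P_of M x -> exists2 z, Q z & z.1 = x) ->
  partial_elementary (Q `|` R) ->
  exists b, partial_elementary (Q `|` R `|` [set (a, b)]).
Proof.
move=> Mdef [p0 Pp0] Nsat LN RN QP PQ QRpe.
have Qpe : partial_elementary Q by apply: partial_elementary_sub QRpe; left.
have [z0 Qz0 _] := PQ _ Pp0.
have lift n (y : 'I_n -> M) : (forall i, P_of M (y i)) ->
    exists2 z : 'I_n -> M * N, forall i, Q (z i) & fst \o z = y.
  move=> Py; have /choice[z zP] i : exists z, Q z /\ z.1 = y i.
    by have [z Qz zy] := PQ _ (Py i); exists z.
  by exists z => [i|]; [case: (zP i)|apply/funext => i; case: (zP i)].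
pose cM : option R -> M := extend_env (fun r : R => (val r).1) a.
(* Defining parameters are kept as pairs in [Q], so that their images in [N] come with them. *)
pose trace (u : instance R) (t : {k & (formula L ('I_u.2.1 + 'I_k) * ('I_k -> M * N))%type}) :=
  (forall i, Q ((projT2 t).2 i)) /\ forall y, (forall i, P_of M (y i)) ->
    (sat M (instance_formula u) (sum_env y cM) <->
     sat M (projT2 t).1 (sum_env y (fst \o (projT2 t).2))).
have /cid tr : exists t : forall u, {k & (formula L ('I_u.2.1 + 'I_k) * ('I_k -> M * N))%type},
    forall u, trace u (t u).
  suff /(_ _)/cid t : forall u, exists t, trace u t.
    by exists (fun u => sval (t u)) => u; exact: svalP (t u).
  move=> u; have [k [psi [d [Pd psiP]]]] := Mdef _ _ (instance_formula u) cM.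
  have [z Qz zd] := lift _ _ Pd.
  by exists (existT _ k (psi, z)); split=> //= y Py; rewrite zd; exact: psiP.
case: tr => t tP.
pose k u := projT1 (t u).
pose psi u : formula L ('I_u.2.1 + 'I_(k u)) := (projT2 (t u)).1.
pose d u : 'I_(k u) -> M * N := (projT2 (t u)).2.
have Qd u i : Q (d u i) by have [+ _] := tP u; apply.
have psiP u y : (forall i, P_of M (y i)) ->
  sat M (instance_formula u) (sum_env y cM) <-> sat M (psi u) (sum_env y (fst \o d u)).
  by have [_ +] := tP u; apply.
pose par (x : R + {u : instance R & 'I_(k u)}) : M * N :=
  match x with inl r => val r | inr (existT u j) => d u j end.
have parQR x : (Q `|` R) (par x).
  by case: x => [r|[u j]]; [right; exact: set_mem (valP r)|left; exact: Qd].
pose A : set N := range (snd \o par).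
have AN : A #< [set: N].
  have RN' : [set: R] #< [set: N].
    by apply: card_lt_trans RN; have /card_eqPle[] := card_setT R.
  have [X [infX XN LX RX]] := common_card_bound (@formulas_infinite L) LN RN'.
  apply: card_lt_trans XN.
  exact: card_le_trans (card_image_le _ _) (card_parameters _ infX LX RX).
have Apar x : A (snd (par x)) by exists x.
pose inA x : A := SigSub (mem_set (Apar x)).
(* [pi] picks a pair of the map above each parameter in [N]; by injectivity ([pi1]) its first
   component is the intended element of [M]. *)
have /choice[pi piP] (z : A) : exists p, (Q `|` R) p /\ p.2 = val z.
  by have /set_mem[x _ xz] := valP z; exists (par x).
have piQR z : (Q `|` R) (pi z) by case: (piP z).
have pi2 : snd \o pi = val by apply/funext => z; case: (piP z).
have pi1 x : (pi (inA x)).1 = (par x).1.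
  by apply/(partial_elementary_inj QRpe) => //; case: (piP (inA x)).
pose theta u : formula L (option A) := all_P (iff_formula
  (rename (instance_formula u) (fun v => match v with
     | inl i => inl i | inr o => inr (omap (inA \o inl) o) end))
  (rename (psi u) (fun v => match v with
     | inl i => inl i | inr j => inr (Some (inA (inr (existT _ u j)))) end))).
have thetaP (K : structure L) u (e : A -> K) (x : K) :
  sat K (theta u) (extend_env e x) <-> forall y, (forall i, P_of K (y i)) ->
    (sat K (instance_formula u) (sum_env y (extend_env (fun r => e (inA (inl r))) x)) <->
     sat K (psi u) (sum_env y (fun j => e (inA (inr (existT _ u j)))))).
  have E1 y : sum_env y (extend_env e x) \o (fun v => match v with
      | inl i => inl i | inr o => inr (omap (inA \o inl) o) end) =
      sum_env y (extend_env (fun r => e (inA (inl r))) x).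
    by apply/funext => -[|[]].
  have E2 y : sum_env y (extend_env e x) \o (fun v => match v with
      | inl i => inl i | inr j => inr (Some (inA (inr (existT _ u j)))) end) =
      sum_env y (fun j => e (inA (inr (existT _ u j)))).
    by apply/funext => -[].
  by rewrite sat_all_P; split=> H y /H; rewrite sat_iff_formula !sat_rename E1 E2.
have Mtheta u : sat M (theta u) (extend_env (fst \o pi) a).
  apply/thetaP => y Py; have := psiP u y Py.
  rewrite (_ : cM = extend_env (fun r => (fst \o pi) (inA (inl r))) a); last first.
    by apply/funext => -[r|] //=; rewrite pi1.
  rewrite (_ : fst \o d u = (fun j => (fst \o pi) (inA (inr (existT _ u j))))) //.
  by apply/funext => j /=; rewrite pi1.
have [|b bP] := Nsat A AN (range theta).
  move=> q qfin qtheta; have [chi chiP] := finite_conjunction qfin.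
  (* [a] witnesses in [M] that the finite part is consistent; the existential statement is carried
     to [N] by the map. *)
  have : sat M (Neg (All (Neg chi))) (fst \o pi).
    move=> /(_ a); apply; apply/chiP => g /qtheta[u _ <-]; exact: Mtheta.
  move=> /(partial_elementary_sat QRpe _ piQR); rewrite pi2 => H.
  apply: contrapT => nH; apply: H => x /chiP sx; apply: nH.
  by exists x => g qg; exact: sx.
exists b => n phi e eP.
(* Pairs outside [Q] are named in [option R], with [None] for [(a, b)]; names of pairs in [Q] are
   irrelevant. *)
have /choice[c cP] i : exists o : option R,
    ~ Q (e i) -> (fst (e i) = cM o /\ snd (e i) = extend_env (fun r : R => (val r).2) b o).
  case: (eP i) => [[Qi|Ri]|->].
  - by exists None.
  - by exists (Some (SigSub (mem_set Ri))).
  - by exists None.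
have [u [h uP]] := instanceP phi [set i | Q (e i)] c.
(* The default [z0] fills positions that are never read. *)
pose z (i : 'I_u.2.1) := if `[< Q (e (cast_ord h i)) >] then e (cast_ord h i) else z0.
have Qz i : Q (z i) by rewrite /z; case: ifPn => // /asboolP.
have E (K : structure L) (f : M * N -> K) (x : K) :
    (forall i, ~ Q (e i) -> f (e i) = extend_env (fun r : R => f (val r)) x (c i)) ->
    sat K (instance_formula u) (sum_env (f \o z) (extend_env (fun r => f (val r)) x)) <->
    sat K phi (f \o e).
  move=> fx; set ee := sum_env _ _.
  transitivity (sat K (rename (instance_formula u) id) ee); first by rewrite sat_rename.
  rewrite uP sat_rename /ee.
  suff -> : sum_env (f \o z) (extend_env (fun r => f (val r)) x) \o
      (fun i => if `[< Q (e i) >] then inl (cast_ord (esym h) i) else inr (c i)) = f \o e by [].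
  apply/funext => i /=; case: ifPn => [Qi|/asboolPn nQ] /=; last by rewrite fx.
  by rewrite /z cast_ordKV Qi.
(* The chain runs from [phi] to its instance, then to [psi] in [M] by the choice of [d], to [psi] in
   [N] by elementarity of [Q], and back to the instance in [N] because [b] realizes [theta u]. *)
rewrite -(E _ fst a) => [|i /cP[]//]; rewrite -(E _ snd b) => [|i /cP[]//].
rewrite (psiP u) => [|i]; last exact: QP.
have Qzd v : Q (sum_env z (d u) v) by case: v => i; [exact: Qz|exact: Qd].
have := partial_elementary_sat Qpe (psi u) Qzd.
have SE (K : Type) (f : M * N -> K) : f \o sum_env z (d u) = sum_env (f \o z) (f \o d u).
  by apply/funext => -[].
rewrite !SE => ->.
have /thetaP/(_ (snd \o z)) := bP _ (imageT theta u).
have PN i : P_of N ((snd \o z) i) by apply/(partial_elementary_P Qpe (Qz i)); exact: QP.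
by move=> /(_ PN) ->.
Qed.

End OneStep.

(** The back step is the forth step for the inverse relation. *)
Lemma partial_elementary_extend_left (L : language) (M N : structure L)
    (Q R : set (M * N)) (b : N) :
  P_traces_definable N -> P_of N !=set0 -> saturated M ->
  formulas L #< [set: M] -> R #< [set: M] ->
  (forall z, Q z -> P_of N z.2) ->
  (forall x, P_of N x -> exists2 z, Q z & z.2 = x) ->
  partial_elementary (Q `|` R) ->
  exists a, partial_elementary (Q `|` R `|` [set (a, b)]).
Proof.
move=> Ndef PN Msat LM RM QP PQ QRpe.
pose sw (S : set (M * N)) : set (N * M) := [set z | S (z.2, z.1)].
have swR : sw R #< [set: M].
  apply: card_lt_trans RM.
  apply: card_le_trans (card_image_le (fun z => (z.2, z.1)) R).
  by apply: subset_card_le => -[x y] Rz; exists (y, x).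
have [||a ape] := partial_elementary_extend b Ndef PN Msat LM swR
  (Q := sw Q) _ _ (partial_elementary_swap QRpe).
- by move=> z; exact: QP.
- by move=> x /PQ[[y z] Qz /= <-]; exists (z, y).
exists a; apply: partial_elementary_sub (partial_elementary_swap ape).
by move=> [x y] [|[-> ->]]; [left|right].
Qed.

(** This is the finite character required by [transfinite_construction]. Only the pairs of the tuple
    lying in [S], listed by [B], have to be covered. *)
Lemma partial_elementary_finite (L : language) (M N : structure L)
    (Q S : set (M * N)) :
  (forall n (e : 'I_n -> M * N), (forall i, S (e i)) ->
    exists2 S', partial_elementary (Q `|` S') & forall i, S' (e i)) ->
  partial_elementary (Q `|` S).
Proof.
move=> HS n phi e eQS.
pose B : pred 'I_n := fun i => `[< S (e i) >].
have [|S' S'pe S'e] := HS #|B| (e \o enum_val).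
  by move=> k; apply/asboolP; exact: (enum_valP k).
apply: S'pe => i; case: (eQS i) => [Qi|/asboolP Bi]; first by left.
by right; have := S'e (enum_rank_in Bi i); rewrite /= (enum_rankK_in Bi Bi).
Qed.

(** Emptiness of [P] is a sentence, on which [M] and [C] agree. *)
Lemma elementary_submodel_P_neq0 (L : language) (C : structure L) (M : set C) :
  P_of C !=set0 -> elementary_submodel M -> P_of (substructure M) !=set0.
Proof.
move=> [p Pp] MC; apply: contrapT => nP.
have [H _] := elementary_on_sat MC (All (Neg (Rel (P_sym L) (fun=> None))))
  (e := of_void _) (fun v => match v with end).
by apply: (H _ p Pp) => x Px; apply: nP; exists x.
Qed.

(** The identity of [P], as a relation because the carriers are different subtypes; equality is
    tested in [C]. *)
Definition diagonal_P (L : language) (C : structure L) (M N : set C) :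
    set (substructure M * substructure N) :=
  [set z | P_of (substructure M) z.1 /\ val z.1 = val z.2].

Lemma diagonal_P_elementary (L : language) (C : structure L) (M N : set C) :
  elementary_submodel M -> elementary_submodel N ->
  partial_elementary (@diagonal_P L C M N).
Proof.
move=> MC NC n phi e eP.
rewrite (MC _ phi) // (NC _ phi) //.
suff -> : val \o (fst \o e) = val \o (snd \o e) by [].
by apply/funext => i; case: (eP i).
Qed.

Lemma diagonal_P_total (L : language) (C : structure L) (M N : set C) :
  P_part M = P_part N -> forall x : substructure M, P_of (substructure M) x ->
  exists2 z, @diagonal_P L C M N z & z.1 = x.
Proof.
move=> MN x Px.
have [Nx _] : P_part N (val x) by rewrite -MN; split=> //; exact: (set_mem (valP x)).
by exists (x, SigSub (mem_set Nx)).
Qed.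

Lemma diagonal_P_total_right (L : language) (C : structure L) (M N : set C) :
  P_part M = P_part N -> forall x : substructure N, P_of (substructure N) x ->
  exists2 z, @diagonal_P L C M N z & z.2 = x.
Proof.
move=> MN x Px.
have [Mx _] : P_part M (val x) by rewrite MN; split=> //; exact: (set_mem (valP x)).
by exists (SigSub (mem_set Mx), x).
Qed.

Lemma card_sum_le (U V X : Type) : infinite_set [set: X] ->
  [set: U] #<= [set: X] -> [set: V] #<= [set: X] -> [set: U + V] #<= [set: X].
Proof.
move=> /infinite_card_seq/card_leT_injP[i iinj] /card_leT_injP[f finj].
move=> /card_leT_injP[g ginj]; apply/card_leT_injP.
exists (fun x => i (match x with inl u => [:: f u] | inr v => [:: g v; g v] end)).
by move=> [u|v] [u'|v'] /iinj // [] => [/finj->|/ginj->].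
Qed.

(** * Saturated models with the same P *)

Section OverP.
Variables (L : language) (C : structure L).
Hypothesis C_stable : stably_embedded C.
Hypothesis C_P : P_of C !=set0.

(** The total function [f] matters only through its graphs over [P] and over [A], which serve as [Q]
    and [R] in the extension lemma. *)
Lemma saturated_extend_one (M M' : set C) (A : set (substructure M'))
    (f : substructure M' -> substructure M) (a : substructure M') :
  elementary_submodel M' -> saturated (substructure M) ->
  formulas L #< M -> A #< M -> elementary_on (P_of (substructure M') `|` A) f ->
  exists2 g : substructure M' -> substructure M,
    elementary_on (P_of (substructure M') `|` A `|` [set a]) g &
    forall x, (P_of (substructure M') `|` A) x -> g x = f x.
Proof.
move=> M'C Msat LM AM fel.
have MT : M #<= [set: substructure M] by have /card_eqPle[] := card_setT M.
pose graph (S : set (substructure M')) : set (substructure M' * substructure M) :=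
  [set z | S z.1 /\ z.2 = f z.1].
have [||||b bpe] := partial_elementary_extend
  (Q := graph (P_of (substructure M'))) (R := graph A) a
  (submodel_P_traces_definable C_stable C_P M'C)
  (elementary_submodel_P_neq0 C_P M'C) Msat (card_lt_le_trans LM MT).
- apply: card_lt_trans (card_lt_le_trans AM MT).
  apply: card_le_trans (card_image_le (fun x => (x, f x)) A).
  by apply: subset_card_le => -[x y] [/= Ax ->]; exists x.
- by move=> z [].
- by move=> x Px; exists (x, f x).
- move=> n phi e eQ.
  have -> : snd \o e = f \o (fst \o e) by apply/funext => i; case: (eQ i) => -[].
  by apply: fel => i; case: (eQ i) => -[]; [left|right].
have inQR x : (P_of (substructure M') `|` A) x ->
    (graph (P_of (substructure M')) `|` graph A `|` [set (a, b)]) (x, f x).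
  by move=> [Px|Ax]; left; [left|right].
(* If [a] already lies in [P] or [A], injectivity forces [b = f a], so the new value does no
   harm. *)
pose g x := if `[< x = a >] then b else f x.
have gf x : (P_of (substructure M') `|` A) x -> g x = f x.
  move=> PAx; rewrite /g; case: asboolP => // xa.
  by apply/(partial_elementary_inj bpe (or_intror erefl) (inQR _ PAx)).
exists g => // n phi e eP.
apply: (bpe n phi (fun i => (e i, g (e i)))) => i.
have [PAe|->] := eP i; first by rewrite gf //; exact: inQR.
by right; rewrite /g asboolT.
Qed.

(** Stage [w] puts [w] into the domain. Since [M'] is no larger than [M], each earlier stage set is
    small enough for the saturation of [M]. *)
Lemma saturated_universal (M M' : set C) :
  elementary_submodel M -> elementary_submodel M' ->
  saturated (substructure M) -> formulas L #< M -> M' #<= M ->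
  P_part M' = P_part M ->
  exists2 f : substructure M' -> substructure M,
    elementary_embedding f & identity_on_P f.
Proof.
move=> MC M'C Msat LM M'M PM.
have MT : M #<= [set: substructure M] by have /card_eqPle[] := card_setT M.
have TM : [set: substructure M'] #<= M'.
  by have /card_eqPle[] := card_setT M'.
have Qpe := diagonal_P_elementary M'C MC.
have [||S w Ssmall Spe|h h1 hpe] := @transfinite_construction (substructure M')
    (substructure M' * substructure M)
    (fun S => partial_elementary (@diagonal_P L C M' M `|` S))
    (fun w => [set z | z.1 = w]).
- by rewrite setU0.
- exact: partial_elementary_finite.
- have [|||b bpe] := partial_elementary_extend w
    (submodel_P_traces_definable C_stable C_P M'C)
    (elementary_submodel_P_neq0 C_P M'C) Msat (card_lt_le_trans LM MT) _ _ _ Spe.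
  + apply: card_lt_le_trans Ssmall _.
    exact: card_le_trans TM (card_le_trans M'M MT).
  + by move=> z [].
  + exact: diagonal_P_total.
  by exists (w, b) => //; rewrite setUA.
exists (fun x => (h x).2) => [n phi e _|x [_ Px]].
  have := hpe n phi (h \o e) (fun i => or_intror (imageT h _)).
  by rewrite (_ : fst \o _ = e) //; apply/funext => i; exact: h1.
(* The diagonal pair of [x] and [h x] share their first component, hence also the second. *)
have [z Qz zx] := diagonal_P_total PM (Px : P_of (substructure M') x).
rewrite -(_ : z.2 = (h x).2); first by case: Qz => _ <-; rewrite zx.
apply/(partial_elementary_inj hpe); [by left|by right; exists x|].
by rewrite zx h1.
Qed.

(** Back and forth is indexed by the disjoint sum: [inl x] puts [x] into the domain, [inr y] puts
    [y] into the range. The sum is no larger than [M], so stage sets stay small. *)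
Lemma saturated_unique (M M' : set C) :
  elementary_submodel M -> elementary_submodel M' ->
  saturated (substructure M) -> saturated (substructure M') ->
  formulas L #< M -> M' #= M -> P_part M = P_part M' ->
  isomorphic_over_P M M'.
Proof.
move=> MC M'C Msat M'sat LM /card_eqPle[M'M MM'] PM.
have /card_eqPle[TM MT] : [set: substructure M] #= M := card_setT M.
have /card_eqPle[TM' MT'] : [set: substructure M'] #= M' := card_setT M'.
have LT := card_lt_le_trans LM MT.
have LT' := card_lt_le_trans (card_lt_le_trans LM MM') MT'.
have infM : infinite_set [set: substructure M].
  by move=> /(card_le_finite (proj1 LT)); exact: formulas_infinite.
have Usmall : [set: substructure M + substructure M'] #<= M.
  apply: card_le_trans TM; apply: card_sum_le => //.
  exact: card_le_trans TM' (card_le_trans M'M MT).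
have Qpe := diagonal_P_elementary MC M'C.
have [||S w Ssmall Spe|h hD hpe] := @transfinite_construction
    (substructure M + substructure M') (substructure M * substructure M')
    (fun S => partial_elementary (@diagonal_P L C M M' `|` S))
    (fun w => [set z | match w with inl x => z.1 = x | inr y => z.2 = y end]).
- by rewrite setU0.
- exact: partial_elementary_finite.
- have SM : S #< M := card_lt_le_trans Ssmall Usmall.
  case: w => [x|y].
    have [|||b bpe] := partial_elementary_extend x
      (submodel_P_traces_definable C_stable C_P MC)
      (elementary_submodel_P_neq0 C_P MC) M'sat LT' _ _ _ Spe.
    + exact: card_lt_le_trans SM (card_le_trans MM' MT').
    + by move=> z [].
    + exact: diagonal_P_total.
    by exists (x, b) => //; rewrite setUA.
  have [|||b bpe] := partial_elementary_extend_left y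
    (submodel_P_traces_definable C_stable C_P M'C)
    (elementary_submodel_P_neq0 C_P M'C) Msat LT _ _ _ Spe.
  + exact: card_lt_le_trans SM MT.
  + by move=> z Qz; apply/(partial_elementary_P Qpe Qz); case: Qz.
  + exact: diagonal_P_total_right.
  by exists (b, y) => //; rewrite setUA.
have h1 x : (h (inl x)).1 = x := hD (inl x).
have h2 y : (h (inr y)).2 = y := hD (inr y).
have hQ w : (@diagonal_P L C M M' `|` range h) (h w) by right; exists w.
exists (fun x => (h (inl x)).2); last first.
  move=> x [_ Px].
  have [z Qz zx] := diagonal_P_total PM (Px : P_of (substructure M) x).
  rewrite -(_ : z.2 = (h (inl x)).2); first by case: Qz => _ <-; rewrite zx.
  apply/(partial_elementary_inj hpe _ (hQ _)); first by left.
  by rewrite zx h1.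
split.
  (* The two choices are mutually inverse because pairs of the relation that agree in one component
     agree in the other. *)
  exists (fun y => (h (inr y)).1) => [x|y].
    rewrite -[RHS]h1; apply/(partial_elementary_inj hpe (hQ _) (hQ _)).
    by rewrite h2.
  rewrite -[RHS]h2; apply/(partial_elementary_inj hpe (hQ _) (hQ _)).
  by rewrite h1.
move=> r a.
have := hpe _ (Rel r id) (fun i => h (inl (a i))) (fun i => hQ _).
have ha : fst \o (fun i => h (inl (a i))) = a by apply/funext => i; exact: h1.
by rewrite ha.
Qed.

End OverP.

Theorem theorem9p9 (L : language) (T : theory L) (kappa : Type)
    (C : structure L)
    (T_complete : complete_theory T)
    (T_P : implies_P_infinite T)
    (C_monster : monster_model T kappa C)
    (P_stable : stably_embedded C)
    (P_induced : no_new_structure C)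
    (T_qe : quantifier_elimination T) :
  (forall M M' : set C,
     elementary_submodel M -> elementary_submodel M' ->
     saturated (substructure M) -> formulas L #< M -> M' #= M ->
     P_part M' = P_part M ->
     (exists2 f : substructure M' -> substructure M,
        elementary_embedding f & identity_on_P f) /\
     (forall (A : set (substructure M'))
             (f : substructure M' -> substructure M)
             (a : substructure M'),
        A #< M ->
        elementary_on (P_of (substructure M') `|` A) f ->
        exists2 g : substructure M' -> substructure M,
          elementary_on (P_of (substructure M') `|` A `|` [set a]) g &
          forall x, (P_of (substructure M') `|` A) x -> g x = f x)) /\
  (forall M M' : set C,
     elementary_submodel M -> elementary_submodel M' ->
     saturated (substructure M) -> saturated (substructure M') ->
     formulas L #< M -> M' #= M ->
     P_part M = P_part M' ->
     isomorphic_over_P M M').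
Proof.
have C_P : P_of C !=set0.
  by case: C_monster => /T_P/infinite_setN0.
split=> [M M' MC M'C Msat LM M'M PM|M M' MC M'C Msat M'sat LM M'M PM].
  split=> [|A f a AM fel]; last exact: saturated_extend_one.
  by apply: saturated_universal => //; case/card_eqPle: M'M.
exact: saturated_unique.
Qed.
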